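(* Let $n\ge1$, $\bm{h}:\mathbb{R}^n\to\mathbb{R}^n$, and let $G\in\mathbb{R}^{n\times n}$ satisfy $G\succeq 0$. Suppose that the autonomous ODE $\dot{\bm{x}}=\bm{h}(\bm{x})$ is stable with respect to the quadratic Lyapunov functional $$V(\bm{x})=\tfrac12\langle \bm{x},G\bm{x}\rangle,$$ namely, $V(\bm{x})\ge0$ and $\langle \bm{h}(\bm{x}),\nabla V(\bm{x})\rangle\le 0$ for all $\bm{x}\in\mathbb{R}^n$. Then the implicit mid-point discretization $$\frac{\bm{x}_{i+1}-\bm{x}_i}{\Delta t}=\bm{h}\!\left(\frac{\bm{x}_i+\bm{x}_{i+1}}{2}\right),\qquad i\ge 0,$$ is unconditionally stable with respect to the same Lyapunov functional. That is, for every $\Delta t>0$ and every sequence $(\bm{x}_i)_{i\ge0}$ in $\mathbb{R}^n$ satisfying the discretization, $V(\bm{x}_{i+1})\le V(\bm{x}_i)$ for all $i\ge0$.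
   Context: $\langle\cdot,\cdot\rangle$ is the Euclidean inner product. $G\succeq0$ means that $G$ is real symmetric and positive semi-definite. A discrete scheme is stable with respect to a Lyapunov functional $V\ge 0$ if $V$ is non-increasing along its iterates; ''unconditionally'' means for every step size $\Delta t>0$. *)

(* Defs.v *)
From mathcomp Require Import all_boot all_order all_algebra.
From mathcomp Require Import all_classical all_reals all_analysis.

Set Implicit Arguments.
Unset Strict Implicit.
Unset Printing Implicit Defensive.

Import Order.TTheory GRing.Theory Num.Theory.
Import numFieldNormedType.Exports.

Local Open Scope classical_set_scope.
Local Open Scope ring_scope.

Definition inner (R : realType) (n : nat) (x y : 'cV[R]_n) : R :=
  \sum_(i < n) x i 0 * y i 0.

Definition psd (R : realType) (n : nat) (G : 'M[R]_n) : Prop :=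
  G^T = G /\ forall x : 'cV[R]_n, 0 <= inner x (G *m x).

(* 'D_v is total: an entry is junk where the corresponding partial derivative
   does not exist. *)
Definition grad (R : realType) (n : nat) (f : 'cV[R]_n -> R) (x : 'cV[R]_n) :
    'cV[R]_n :=
  \col_(i < n) 'D_(delta_mx i 0) f x.

Definition quadratic_functional (R : realType) (n : nat) (G : 'M[R]_n)
    (x : 'cV[R]_n) : R :=
  2^-1 * inner x (G *m x).

Definition lyapunov_stable_ode (R : realType) (n : nat)
    (h : 'cV[R]_n -> 'cV[R]_n) (V : 'cV[R]_n -> R) : Prop :=
  (forall x, 0 <= V x) /\ (forall x, inner (h x) (grad V x) <= 0).

Definition implicit_midpoint (R : realType) (n : nat)
    (h : 'cV[R]_n -> 'cV[R]_n) (dt : R) (x : nat -> 'cV[R]_n) : Prop :=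
  forall i : nat,
    dt^-1 *: (x i.+1 - x i) = h (2^-1 *: (x i + x i.+1)).

(* A scheme is given by the step-size-indexed set of its solution sequences, so
   that implicit schemes, whose iterates need neither exist nor be unique, are
   covered. *)
Definition unconditionally_stable (R : realType) (n : nat)
    (scheme : R -> (nat -> 'cV[R]_n) -> Prop) (V : 'cV[R]_n -> R) : Prop :=
  forall dt : R, 0 < dt ->
  forall x : nat -> 'cV[R]_n, scheme dt x ->
  forall i : nat, V (x i.+1) <= V (x i).

(* Main.v *)
(** Since G is symmetric, the gradient of V is G x and
    V(y) - V(x) = <y - x, G((x + y) / 2)>. Along the scheme, y - x is dt times
    h at the midpoint (x + y) / 2, so the increment of V is exactly dt times
    the dissipation rate of the ODE at the midpoint, which is nonpositive. *)
Require Import Defs.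
From mathcomp Require Import all_boot all_order all_algebra.
From mathcomp Require Import all_classical all_reals all_analysis.
From mathcomp Require Import ring.

Import Order.TTheory GRing.Theory Num.Theory.
Import numFieldNormedType.Exports.

Local Open Scope classical_set_scope.
Local Open Scope ring_scope.

Lemma innerC (R : realType) (n : nat) (x y : 'cV[R]_n) : inner x y = inner y x.
Proof. by apply: eq_bigr => i _; rewrite mulrC. Qed.

Lemma innerDl (R : realType) (n : nat) (x y z : 'cV[R]_n) :
  inner (x + y) z = inner x z + inner y z.
Proof. by rewrite -big_split; apply: eq_bigr => i _; rewrite mxE mulrDl. Qed.

Lemma innerZl (R : realType) (n : nat) (a : R) (x y : 'cV[R]_n) :
  inner (a *: x) y = a * inner x y.
Proof. by rewrite mulr_sumr; apply: eq_bigr => i _; rewrite mxE mulrA. Qed.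

Lemma innerDr (R : realType) (n : nat) (x y z : 'cV[R]_n) :
  inner x (y + z) = inner x y + inner x z.
Proof. by rewrite innerC innerDl !(innerC _ _ x). Qed.

Lemma innerZr (R : realType) (n : nat) (a : R) (x y : 'cV[R]_n) :
  inner x (a *: y) = a * inner x y.
Proof. by rewrite innerC innerZl innerC. Qed.

(** Associativity of the matrix product, once the inner product is read as the single entry of
    [u^T *m v]. *)
Lemma inner_mulmx (R : realType) (n : nat) (A : 'M[R]_n) (x y : 'cV[R]_n) :
  inner x (A *m y) = inner (A^T *m x) y.
Proof.
have innerE (u v : 'cV[R]_n) : inner u v = (u^T *m v) 0 0.
  by rewrite mxE; apply: eq_bigr => i _; rewrite mxE.
by rewrite !innerE trmx_mul trmxK mulmxA.
Qed.

Lemma inner_delta_mx (R : realType) (n : nat) (i : 'I_n) (x : 'cV[R]_n) :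
  inner (delta_mx i 0) x = x i 0.
Proof.
rewrite /inner (bigD1 i) //= big1 => [|j ji]; rewrite mxE ?eqxx ?mul1r ?addr0 //.
by rewrite (negPf ji) mul0r.
Qed.

(** Symmetry of [G] makes the two cross terms equal, so together they absorb the factor 1/2. This
    exact expansion yields both the gradient and the midpoint identity. *)
Lemma quadratic_functionalD (R : realType) (n : nat) (G : 'M[R]_n)
    (x v : 'cV[R]_n) : G^T = G ->
  quadratic_functional G (v + x) =
  quadratic_functional G v + inner v (G *m x) + quadratic_functional G x.
Proof.
move=> symG; rewrite /quadratic_functional mulmxDr !innerDr !innerDl.
have -> : inner x (G *m v) = inner v (G *m x) by rewrite inner_mulmx symG innerC.
by field.
Qed.

Lemma quadratic_functionalZ (R : realType) (n : nat) (G : 'M[R]_n) (a : R)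
    (v : 'cV[R]_n) :
  quadratic_functional G (a *: v) = a ^+ 2 * quadratic_functional G v.
Proof. by rewrite /quadratic_functional -scalemxAr innerZl innerZr; ring. Qed.

(** For t nonzero the difference quotient along [v] equals t V(v) + <v, G x>, affine in t, so its
    limit at 0 is read off directly. *)
Lemma derive_quadratic_functional (R : realType) (n : nat) (G : 'M[R]_n)
    (x v : 'cV[R]_n) : G^T = G ->
  'D_v (quadratic_functional G) x = inner v (G *m x).
Proof.
move=> symG; apply: cvg_lim => //.
have cvgE : (fun t : R => t * quadratic_functional G v + inner v (G *m x)) t
    @[t --> 0^'] --> inner v (G *m x).
  rewrite -[X in _ --> X]add0r -[X in _ --> X + _](mul0r (quadratic_functional G v)).
  apply: cvgD; last exact: cvg_cst.
  by apply: cvgMl; apply: cvg_within.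
apply: cvg_trans cvgE; apply: near_eq_cvg; near=> t.
(* The limit is over a punctured neighbourhood, so dividing by [t] is legitimate. *)
have t0 : t != 0 by near: t; exact: nbhs_dnbhs_neq.
rewrite /= quadratic_functionalD // quadratic_functionalZ innerZl.
by rewrite /GRing.scale /=; field.
Unshelve. all: by end_near. Qed.

Lemma grad_quadratic_functional (R : realType) (n : nat) (G : 'M[R]_n)
    (x : 'cV[R]_n) : G^T = G -> grad (quadratic_functional G) x = G *m x.
Proof.
move=> symG; apply/colP => i.
by rewrite mxE derive_quadratic_functional // inner_delta_mx.
Qed.

(** A mean value formula without remainder: V is quadratic, so its gradient is linear and the
    midpoint rule integrates it exactly along the segment. *)
Lemma quadratic_functional_midpoint (R : realType) (n : nat) (G : 'M[R]_n)
    (x y : 'cV[R]_n) : G^T = G ->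
  quadratic_functional G y =
  quadratic_functional G x + inner (y - x) (G *m (2^-1 *: (x + y))).
Proof.
move=> symG; rewrite -{1}(subrK x y) quadratic_functionalD // addrC; congr (_ + _).
(* The half increment supplies the term V(y - x) of the expansion, and [x] supplies the cross
   term. *)
have -> : 2^-1 *: (x + y) = 2^-1 *: (y - x) + x.
  by apply/colP => i; rewrite !mxE; field.
by rewrite mulmxDr innerDr -scalemxAr innerZr.
Qed.

Theorem theorem3 (R : realType) (n : nat) (hn : (1 <= n)%N)
    (h : 'cV[R]_n -> 'cV[R]_n) (G : 'M[R]_n) (hG : psd G)
    (hstable : lyapunov_stable_ode h (quadratic_functional G)) :
  unconditionally_stable (implicit_midpoint h) (quadratic_functional G).
Proof.
case: hG => symG _; case: hstable => _ dissip dt dt0 x step i.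
have := dissip (2^-1 *: (x i + x i.+1)).
rewrite grad_quadratic_functional // -step innerZl => rate_le0.
rewrite (quadratic_functional_midpoint _ _ _ (x i)) // gerDl.
(* Only the sign of [dt] matters here, hence no restriction on the step size. *)
by rewrite -(pmulr_rle0 _ (_ : 0 < dt^-1)) ?invr_gt0.
Qed.
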